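(* Let $\mathbb{H}$ be a real separable infinite-dimensional Hilbert space with orthonormal basis $(e_i)_{i\ge1}$, let $(X_i)_{i\ge1}$ be i.i.d. $N(0,1)$ random variables on a probability space $(\Omega,\mathbb{F},P)$, and let $W(f)=\sum_{i=1}^\infty\langle f,e_i\rangle X_i$, $f\in\mathbb{H}$, be the Gaussian white noise. Then almost surely $W$ is an improper unbounded linear functional, in the sense that for almost all $\omega\in\Omega$: (a) there exists a sequence of unit vectors $f_1,f_2,\dots\in\mathbb{H}$ such that $W(f_k)(\omega)$ is finite for all $k$, but $\lim_{k\to\infty}W(f_k)(\omega)=\infty$; (b) there exists $g\in\mathbb{H}$ such that $W(g)(\omega)=\infty$.
   Context: Convention: $W(f)(\omega)=\sum_{i=1}^\infty\langle f,e_i\rangle X_i(\omega)$ (limit of partial sums), with $W(f)(\omega)=\infty$ when the series does not converge. The sequence in (a) and the vector in (b) may depend on $\omega$. *)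

(* Defs.v *)
From mathcomp Require Import all_boot all_order all_algebra.
From mathcomp Require Import all_classical all_reals all_analysis.
Set Implicit Arguments.
Unset Strict Implicit.
Unset Printing Implicit Defensive.
Import Order.TTheory GRing.Theory Num.Theory.
Import numFieldNormedType.Exports.
Local Open Scope classical_set_scope.
Local Open Scope ring_scope.

(* With [H] complete, this makes [H] a real Hilbert space: [ip] is bilinear,
   symmetric, positive definite, and induces the norm of [H]. *)
Definition hilbert_inner_product (R : realType) (H : completeNormedModType R)
    (ip : {dot H for idfun}) : Prop :=
  forall x : H, `|x| ^+ 2 = ip x x.

Definition separable (T : topologicalType) : Prop :=
  exists2 A : set T, countable A & dense A.

Definition infinite_dimensional (R : realType) (V : lmodType R) : Prop :=
  ~ exists (n : nat) (s : 'I_n -> V),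
      forall v : V, exists c : 'I_n -> R, v = \sum_(i < n) c i *: s i.

Definition orthonormal_seq (R : realType) (H : completeNormedModType R)
    (ip : {dot H for idfun}) (e : nat -> H) : Prop :=
  forall i j, ip (e i) (e j) = (i == j)%:R.

Definition linear_span (R : realType) (H : completeNormedModType R)
    (e : nat -> H) : set H :=
  [set x | exists (n : nat) (c : nat -> R), x = \sum_(i < n) c i *: e i].

(* Sequences are indexed from 0: [e i] and [X i] below stand for e_(i+1) and
   X_(i+1). *)
Definition orthonormal_basis (R : realType) (H : completeNormedModType R)
    (ip : {dot H for idfun}) (e : nat -> H) : Prop :=
  orthonormal_seq ip e /\ closure (linear_span e) = setT.

Definition independent_seq (d : measure_display) (Omega : measurableType d)
    (R : realType) (P : probability Omega R) (X : nat -> {RV P >-> R}) : Prop :=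
  forall (J : seq nat) (B : nat -> set R),
    uniq J -> (forall i, measurable (B i)) ->
    P (\bigcap_(i in [set` J]) (X i @^-1` B i)) =
    (\prod_(i <- J) P (X i @^-1` B i))%E.

(* The laws are compared on measurable sets only, since the value of a measure
   elsewhere is irrelevant. *)
Definition std_normal (d : measure_display) (Omega : measurableType d)
    (R : realType) (P : probability Omega R) (Y : {RV P >-> R}) : Prop :=
  forall B : set R, measurable B -> distribution P Y B = normal_prob 0 1 B.

Definition iid_std_normal (d : measure_display) (Omega : measurableType d)
    (R : realType) (P : probability Omega R) (X : nat -> {RV P >-> R}) : Prop :=
  independent_seq X /\ forall i, std_normal (X i).

Definition noise_series (d : measure_display) (Omega : measurableType d)
    (R : realType) (P : probability Omega R) (H : completeNormedModType R)
    (ip : {dot H for idfun}) (e : nat -> H) (X : nat -> {RV P >-> R})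
    (f : H) (w : Omega) : R^nat :=
  series (fun i => ip f (e i) * X i w).

(* Any divergence of the partial sums, oscillation and divergence to minus
   infinity included, gives the value +oo. *)
Definition white_noise (d : measure_display) (Omega : measurableType d)
    (R : realType) (P : probability Omega R) (H : completeNormedModType R)
    (ip : {dot H for idfun}) (e : nat -> H) (X : nat -> {RV P >-> R})
    (f : H) (w : Omega) : \bar R :=
  if `[< cvgn (noise_series ip e X f w) >]
  then (limn (noise_series ip e X f w))%:E else +oo%E.

(* Main.v *)
(* Almost surely [\sum_i X i w ^+ 2] diverges: the events [X i \in `[1, 2]] are
   independent with the same positive probability, so infinitely many of them
   occur. Fix such an [w] and let [S n] be the partial sums. For (a), normalizing
   [\sum_(i < n) X i w *: e i] gives a unit vector at which the noise takes the
   value [Num.sqrt (S n)]. For (b), by the Abel-Dini theorem the coefficients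
   [X i w / (1 + S i.+1)] are square summable, hence are those of some [g] in
   [H], whereas [\sum_i X i w ^+ 2 / (1 + S i.+1)] diverges. *)
Require Import Defs.
From mathcomp Require Import all_boot all_order all_algebra.
From mathcomp Require Import all_classical all_reals all_analysis.
From mathcomp Require Import measurable_realfun ring lra.
Import Order.TTheory GRing.Theory Num.Theory.
Import numFieldNormedType.Exports.
Local Open Scope classical_set_scope.
Local Open Scope ring_scope.

(** * Abel-Dini theorem for a divergent series of nonnegative terms *)

Section AbelDini.
Variables (R : realType) (u : R^nat).
Hypothesis u_ge0 : forall n, 0 <= u n.
Hypothesis u_dvg : series u n @[n --> \oo] --> +oo.

(** The added 1 keeps the denominators positive even if the first terms of [u] vanish. *)
Let tail n : R := 1 + series u n.+1.

Let series_ge0 n : 0 <= series u n.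
Proof. by apply: sumr_ge0. Qed.

Let series_homo : {homo series u : n m / (n <= m)%N >-> n <= m}.
Proof.
by move=> n m nm; rewrite -subr_ge0 sub_series_geq //; apply: sumr_ge0.
Qed.

Let tail_gt0 n : 0 < tail n.
Proof. by rewrite /tail ltr_pwDl. Qed.

Lemma abel_dini_cvg : cvgn (series (fun n => u n / (1 + series u n.+1) ^+ 2)).
Proof.
apply: nondecreasing_is_cvgn.
  move=> n m nm; rewrite -subr_ge0 sub_series_geq //; apply: sumr_ge0 => i _.
  by rewrite divr_ge0 ?sqr_ge0.
exists 1 => _ [n _ <-].
(* with [S n = 1 + series u n], [u n / S n.+1 ^+ 2 <= 1 / S n - 1 / S n.+1] telescopes *)
apply: (@le_trans _ _ (1 - (1 + series u n)^-1)); last first.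
  by rewrite gerBl invr_ge0 addr_ge0.
elim: n => [|n IHn]; first by rewrite /series /= !big_geq// addr0 invr1 subrr.
rewrite [leLHS]seriesSr.
apply: le_trans (lerD IHn (lexx _)) _.
have S0 : 0 < 1 + series u n by rewrite ltr_pwDl.
have T0 := tail_gt0 n; rewrite /tail in T0.
have TE : u n = (1 + series u n.+1) - (1 + series u n).
  by rewrite seriesSr; ring.
have ST : 1 + series u n <= 1 + series u n.+1 by rewrite lerD2l series_homo.
rewrite {}TE; move: (1 + series u n) (1 + series u n.+1) S0 T0 ST => S T S0 T0 ST.
have -> : (T - S) / T ^+ 2 = (S / T) * (S^-1 - T^-1).
  by field; rewrite !gt_eqF.
have : (S / T) * (S^-1 - T^-1) <= 1 * (S^-1 - T^-1).
  apply: ler_wpM2r; first by rewrite subr_ge0 lef_pV2.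
  by rewrite ler_pdivrMr// mul1r.
lra.
Qed.

(** Cauchy's criterion fails: from any start [N], the block up to [n] is bounded below by a quotient
    that tends to 1 as [n] grows. *)
Lemma abel_dini_dvg : ~ cvgn (series (fun n => u n / (1 + series u n.+1))).
Proof.
move=> /cvg_cauchy/cauchy_seriesP/(_ 2^-1 ltac:(by rewrite invr_gt0)).
move=> [[A B] /= [[N1 _ hA] [N2 _ hB]] hAB].
pose N := maxn N1 N2.
(* Beyond this threshold that quotient is at least 1/2. *)
have /cvgryPge/(_ (2 * series u N + 1))[N3 _ h3] := u_dvg.
pose n := maxn N N3.
have Nn : (N <= n)%N by rewrite leq_maxl.
have Sn : 2 * series u N + 1 <= series u n by apply: h3; rewrite /= leq_maxr.
have /hAB/= : (A `*` B) (N, n).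
  by split; [apply: hA|apply: hB]; rewrite /= /n /N !leq_max leqnn ?orbT.
apply/negP; rewrite -leNgt; apply: le_trans (ler_norm _).
(* the block from [N] to [n] is at least [(series u n - series u N) / (1 + series u n)] *)
apply: (@le_trans _ _ (\sum_(N <= k < n) u k / (1 + series u n))).
  rewrite -mulr_suml -sub_series_geq// ler_pdivlMr ?ltr_pwDl//.
  lra.
apply: ler_sum_nat => i /andP[_ ni].
rewrite ler_wpM2l// lef_pV2 ?posrE ?ltr_pwDl//.
by rewrite lerD2l series_homo.
Qed.

End AbelDini.

(** * Coefficients along an orthonormal sequence *)

Section Hilbert.
Variables (R : realType) (H : completeNormedModType R) (ip : {dot H for idfun}).
Hypothesis Hip : hilbert_inner_product ip.
Variable e : nat -> H.
Hypothesis He : orthonormal_seq ip e.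

Lemma ip_sum_basis (c : R^nat) m n j :
  ip (\sum_(m <= i < n) c i *: e i) (e j) = if (m <= j < n)%N then c j else 0.
Proof.
rewrite linear_sumlz /=.
under eq_bigr do rewrite linearZl_LR /= He.
case: ifPn => [jn|jn].
  rewrite (bigD1_seq j) ?mem_index_iota ?iota_uniq//= eqxx mulr1.
  by rewrite big1 ?addr0// => i /negbTE ->; rewrite mulr0.
rewrite big_nat big1// => i imn.
case: eqVneq => [ij|]; last by rewrite mulr0.
by rewrite -ij imn in jn.
Qed.

Lemma norm_sum_basis (c : R^nat) m n :
  `|\sum_(m <= i < n) c i *: e i| ^+ 2 = \sum_(m <= i < n) c i ^+ 2.
Proof.
rewrite Hip linear_sumr /= big_nat [RHS]big_nat; apply: eq_bigr => j jmn.
by rewrite linearZr_LR /= ip_sum_basis jmn expr2.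
Qed.

(** Pythagoras: the difference of the squares is the squared distance from [x] to the line through
    [e j]. It lets coefficients pass to limits in [H]. *)
Lemma normr_ip_le x j : `|ip x (e j)| <= `|x|.
Proof.
rewrite -(@ler_pXn2r _ 2) ?nnegrE// real_normK ?num_real//.
rewrite -subr_ge0.
suff -> : `|x| ^+ 2 - ip x (e j) ^+ 2 = `|x - ip x (e j) *: e j| ^+ 2.
  by rewrite sqr_ge0.
rewrite !Hip linearBl !linearBr /= !linearZl_LR !linearZr_LR /= He eqxx.
have -> : ip (e j) x = ip x (e j).
  by rewrite (hermC ip) expr0 mul1r.
rewrite /= mulr1 -[_ *: _]/(_ * _); ring.
Qed.

(** Blocks of the vector series have as squared norms the blocks of the scalar series, so both are
    Cauchy, and completeness of [H] provides [g]. *)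
Lemma riesz_fischer (c : R^nat) :
  cvgn (series (fun i => c i ^+ 2)) -> exists g, forall j, ip g (e j) = c j.
Proof.
move=> /cvg_cauchy/cauchy_seriesP c_cauchy.
have /cauchy_cvgP S_cvg : cauchy (series (fun i => c i *: e i) n @[n --> \oo]).
  apply/cauchy_seriesP => eps eps0.
  have [[A B] /= AB hAB] := c_cauchy (eps ^+ 2) (exprn_gt0 2 eps0).
  exists (A, B) => // -[m n] /hAB /=.
  rewrite -norm_sum_basis ger0_norm ?sqr_ge0//.
  by rewrite ltr_pXn2r ?nnegrE// ltW.
exists (limn (series (fun i => c i *: e i))) => j.
apply/eqP; rewrite -subr_eq0 -normr_le0; apply/ler_addgt0Pl => eps eps0.
rewrite addr0.
have /cvgrPdist_lt/(_ eps eps0)[N _ hN] := S_cvg.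
(* From [j.+1] terms on, the partial sums have [c j] as their exact [j]-th coefficient. *)
have {hN} := hN (maxn N j.+1) (leq_maxl _ _).
set g := lim _ => /ltW; apply: le_trans.
apply: le_trans (normr_ip_le _ j).
by rewrite linearBl /= /series /= ip_sum_basis leq0n leq_max ltnSn orbT.
Qed.

End Hilbert.

(** * Almost sure divergence of the sum of squares *)

(** By independence, staying in [B] for [n] consecutive indices has probability at most [q ^+ n]. So
    staying in [B] forever from [N] on is a null event, and there are countably many [N]. *)
Lemma independent_infinitely_often (R : realType) (d : measure_display)
    (Omega : measurableType d) (P : probability Omega R)
    (X : nat -> {RV P >-> R}) (B : set R) (q : R) :
  independent_seq X -> measurable B -> q < 1 ->
  (forall i, (P (X i @^-1` B) <= q%:E)%E) ->
  {ae P, forall w, forall N, exists2 i, (N <= i)%N & ~ B (X i w)}.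
Proof.
move=> X_ind mB q1 PB.
have q0 : 0 <= q by rewrite -lee_fin; apply: le_trans (PB 0%N); apply: measure_ge0.
have mXB i : measurable (X i @^-1` B) by apply: measurable_funPTI.
pose A N := \bigcap_(i in [set i | (N <= i)%N]) (X i @^-1` B).
have mA N : measurable (A N).
  by apply: bigcap_measurable => //; exists N => /=.
have A_negl N : P.-negligible (A N).
  exists (A N); split => //.
  have PA n : (P (A N) <= (q ^+ n)%:E)%E.
    apply: (@le_trans _ _ (P (\bigcap_(i in [set` iota N n]) (X i @^-1` B)))).
      apply: le_measure; rewrite ?inE//.
        by apply: fin_bigcap_measurable => //; exact: finite_seq.
      by move=> w Aw i /=; rewrite mem_iota => /andP[Ni _]; exact: Aw.
    rewrite (X_ind (iota N n) (fun=> B)) ?iota_uniq//.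
    elim: n N => [|n IHn] N0; first by rewrite big_nil expr0.
    by rewrite /= big_cons exprS EFinM lee_pmul// ?measure_ge0// prode_ge0.
  apply/eqP; rewrite eq_le measure_ge0 andbT.
  apply/lee_addgt0Pr => eps eps0; rewrite add0e.
  have /cvgrPdist_lt/(_ eps eps0)[n _ /(_ n (leqnn _)) /=] : (q ^+ n @[n --> \oo] --> 0).
    by apply: cvg_expr; rewrite ger0_norm.
  rewrite sub0r normrN ger0_norm ?exprn_ge0// => qn.
  by apply: le_trans (PA n) _; rewrite lee_fin ltW.
apply: negligibleS (negligible_bigcup A_negl) => w /= /existsNP[N wN].
exists N => // i /= Ni; apply: contrapT => nB; apply: wN.
by exists i.
Qed.

(** The density decreases on [[1, 2]], an interval of length 1, so its value at 2 bounds the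
    integral from below. *)
Lemma normal_prob_itv_gt0 (R : realType) :
  (0 < normal_prob (0 : R) 1 `[1%R, 2%R]%classic)%E.
Proof.
have pdf2 : 0 < normal_pdf (0 : R) 1 2.
  by rewrite normal_pdfE ?oner_neq0// mulr_gt0 ?expR_gt0 ?normal_peak_gt0
    ?oner_neq0.
pose I : set R := `[1, 2]%classic.
apply: (@lt_le_trans _ _
    (\int[lebesgue_measure]_(x in I) cst (normal_pdf 0 1 2)%:E x)%E).
  have muI : lebesgue_measure I = 1%E.
    by rewrite lebesgue_measure_itv /= lte_fin ltr1n -EFinB; congr EFin; lra.
  rewrite integral_cst; last exact: measurable_itv.
  by rewrite [X in (_ * X)%E]muI mule1 lte_fin.
apply: ge0_le_integral => //; first exact: measurable_itv.
- by move=> x _ /=; rewrite lee_fin ltW.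
- apply/measurable_EFinP; apply: measurable_funTS.
  exact: measurable_normal_pdf.
- move=> x; rewrite /I /= in_itv /= => /andP[x1 x2].
  rewrite lee_fin !normal_pdfE ?oner_neq0// ler_wpM2l ?normal_peak_ge0//.
  rewrite /normal_fun !subr0 ler_expR !mulNr lerN2.
  rewrite ler_wpM2r// ?invr_ge0 ?mulrn_wge0//.
  by rewrite ler_pXn2r// nnegrE; lra.
Qed.

Lemma sum_sqr_normal_dvg (R : realType) (d : measure_display)
    (Omega : measurableType d) (P : probability Omega R)
    (X : nat -> {RV P >-> R}) : iid_std_normal X ->
  {ae P, forall w, series (fun i => X i w ^+ 2) n @[n --> \oo] --> +oo}.
Proof.
move=> [X_ind X_norm].
pose p : R := fine (normal_prob (0 : R) 1 `[1, 2]%classic).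
have pE : normal_prob (0 : R) 1 `[1, 2]%classic = p%:E.
  by rewrite fineK//; exact: fin_num_measure.
have p0 : 0 < p by rewrite -lte_fin -pE normal_prob_itv_gt0.
have PB i : (P (X i @^-1` (~` `[1%R, 2%R])) <= (1 - p)%:E)%E.
  rewrite preimage_setC probability_setC; last first.
    exact: (measurable_funPTI (X i) (measurable_itv `[1, 2])).
  have := X_norm i _ (measurable_itv `[1, 2]).
  by rewrite /distribution/= /pushforward => ->; rewrite pE EFinB.
have p1 : 1 - p < 1 by rewrite gtrBl.
have := independent_infinitely_often _ _ _ _ _ _ _ X_ind
  (measurableC (measurable_itv `[1, 2])) p1 PB.
apply: filterS => w Xw.
(* Nondecreasing partial sums tend to infinity unless they converge; convergence would force the
   terms to 0, against [1 <= X i w] infinitely often. *)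
apply: nondecreasing_dvgn_lt.
  move=> n m nm; rewrite -subr_ge0 sub_series_geq//.
  by apply: sumr_ge0 => i _; exact: sqr_ge0.
move=> /cvg_series_cvg_0/cvgrPdist_lt/(_ 1 ltr01)[N _ hN].
have [i /hN /= + /contrapT] := Xw N.
rewrite sub0r normrN ger0_norm ?sqr_ge0//= in_itv /= => + /andP[Xi1 _].
by apply/negP; rewrite -leNgt exprn_ege1.
Qed.

(** * The noise at a fixed outcome *)

Section WhiteNoise.
Variables (R : realType) (H : completeNormedModType R) (ip : {dot H for idfun}).
Hypothesis Hip : hilbert_inner_product ip.
Variable e : nat -> H.
Hypothesis He : orthonormal_seq ip e.
Variables (d : measure_display) (Omega : measurableType d).
Variables (P : probability Omega R) (X : nat -> {RV P >-> R}) (w : Omega).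

Let S := series (fun i => X i w ^+ 2).
Hypothesis S_dvg : S n @[n --> \oo] --> +oo.

(** If [S n = 0], the scalar is the inverse of 0, which is 0, and the vector is null; hence the
    condition [0 < S n] below. *)
Let unit_vec n : H := (Num.sqrt (S n))^-1 *: \sum_(0 <= i < n) X i w *: e i.

Let norm_unit_vec n : 0 < S n -> `|unit_vec n| = 1.
Proof.
move=> Sn0; rewrite normrZ ger0_norm ?invr_ge0 ?sqrtr_ge0//.
rewrite -[`|\sum_(_ <= _ < _) _|]ger0_norm// -sqrtr_sqr
  (norm_sum_basis _ _ _ Hip _ He).
by rewrite mulVf// gt_eqF// sqrtr_gt0.
Qed.

Let white_noise_unit_vec n : 0 < S n ->
  white_noise ip e X (unit_vec n) w = (Num.sqrt (S n))%:E.
Proof.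
move=> Sn0.
(* The coefficients vanish from index [n] on, so the series is eventually constant. *)
have ev : \forall m \near \oo,
    noise_series ip e X (unit_vec n) w m = Num.sqrt (S n).
  exists n => // m /= nm; rewrite /noise_series /series /= (big_cat_nat _ nm)//=.
  rewrite [X in _ + X]big_nat [X in _ + X]big1 ?addr0 => [|i /andP[ni _]]; last first.
    by rewrite linearZl_LR /= ip_sum_basis// ltnNge ni/= mulr0 mul0r.
  have -> : Num.sqrt (S n) = (Num.sqrt (S n))^-1 * S n.
    by rewrite -[X in _ * X]sqr_sqrtr ?ltW// expr2 mulKf// gt_eqF// sqrtr_gt0.
  rewrite [in RHS]mulr_sumr !big_nat; apply: eq_bigr => i ini.
  by rewrite linearZl_LR /= ip_sum_basis// ini expr2 mulrA.
have cv : noise_series ip e X (unit_vec n) w m @[m --> \oo] --> Num.sqrt (S n).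
  exact: cvg_near_cst.
rewrite /white_noise asboolT; last by apply/cvg_ex; exists (Num.sqrt (S n)).
by congr EFin; exact/cvg_lim.
Qed.

Lemma white_noise_unbounded : exists f : nat -> H,
  [/\ (forall k, `|f k| = 1),
      (forall k, white_noise ip e X (f k) w \is a fin_num) &
      white_noise ip e X (f k) w @[k --> \oo] --> +oo%E].
Proof.
have /cvgryPgt/(_ 0)[N _ SN] := S_dvg.
have SkN k : 0 < S (k + N) by apply: SN; rewrite /= leq_addl.
(* The shift by [N] skips the indices at which [S] may vanish. *)
exists (fun k => unit_vec (k + N)); split => [k|k|].
- exact: norm_unit_vec.
- by rewrite white_noise_unit_vec.
under eq_fun do rewrite white_noise_unit_vec//.
apply/cvgeryP/cvgryPge => A.
(* The square also covers negative [A], through [A <= |A|]. *)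
have /cvgryPge/(_ (A ^+ 2))[M _ SM] := S_dvg.
exists M => // k /= Mk.
apply: le_trans (ler_norm A) _; rewrite -sqrtr_sqr ler_wsqrtr//.
by apply: SM; rewrite /= (leq_trans Mk) ?leq_addr.
Qed.

Lemma white_noise_infinite : exists g : H, white_noise ip e X g w = +oo%E.
Proof.
have X2_ge0 i : 0 <= X i w ^+ 2 by exact: sqr_ge0.
have [|g gE] := riesz_fischer _ _ _ Hip _ He (fun i => X i w / (1 + S i.+1)).
  under [X in series X]eq_fun do rewrite expr_div_n.
  exact: abel_dini_cvg.
exists g; rewrite /white_noise asboolF//.
(* The terms are nonnegative, so here the value [+oo] is a true limit and not only the convention
   for divergence. *)
have -> : noise_series ip e X g w = series (fun i => X i w ^+ 2 / (1 + S i.+1)).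
  by congr series; apply/funext => i; rewrite gE expr2 mulrAC.
exact: abel_dini_dvg.
Qed.

End WhiteNoise.

Theorem proposition5 (R : realType)
    (H : completeNormedModType R) (ip : {dot H for idfun})
    (Hip : hilbert_inner_product ip)
    (Hsep : separable H) (Hinf : infinite_dimensional H)
    (e : nat -> H) (He : orthonormal_basis ip e)
    (d : measure_display) (Omega : measurableType d) (P : probability Omega R)
    (X : nat -> {RV P >-> R}) (HX : iid_std_normal X) :
  {ae P, forall w : Omega,
    (exists f : nat -> H,
       [/\ (forall k, `|f k| = 1),
           (forall k, white_noise ip e X (f k) w \is a fin_num) &
           white_noise ip e X (f k) w @[k --> \oo] --> +oo%E]) /\
    (exists g : H, white_noise ip e X g w = +oo%E)}.
Proof.
have [e_orth _] := He.
have := sum_sqr_normal_dvg _ _ _ _ _ HX.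
apply: filterS => w S_dvg.
by split; [exact: white_noise_unbounded | exact: white_noise_infinite].
Qed.
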